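(* Let $n\ge 6$. The graph $G(3,n)$ is bipartite with partite sets $X=\{v: v\equiv 0 \pmod 4\}$ and $Y=\{v : v\equiv 2\pmod 4\}$, and its vertex set can be partitioned into an independent set $I$ and a set inducing a path $P$ such that every vertex of $P$ is adjacent to all vertices of $I$ lying in the partite set opposite to it (so consecutive vertices of $P$ are alternately adjacent to all of $I\cap Y$ and all of $I\cap X$), and these together with the edges of $P$ are all the edges of $G(3,n)$. Moreover, $G(3,1)\cong K_1$, $G(3,2)\cong K_2$, $G(3,3)\cong P_3$, $G(3,4)\cong C_4$, and $G(3,5)$ consists of a $4$-cycle together with a pendant vertex attached to one vertex of the cycle.
   Context: For a prime $p$ and $n\in\mathbb{N}$, $G(p,n)$ is the simple graph with vertex set $\{2,4,\ldots,2n\}$ in which two distinct vertices $a,b$ are adjacent if and only if both $\frac{a+b}{2}$ and $\frac{|a-b|}{2}$ are odd positive integers neither of which equals $pk$ for an integer $k\ge 2$. $P_k$ denotes the path on $k$ vertices and $C_k$ the cycle on $k$ vertices. *)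

(* Defs.v *)
From HB Require Import structures.
From mathcomp Require Import all_boot all_order all_algebra.
Set Implicit Arguments.
Unset Strict Implicit.
Unset Printing Implicit Defensive.

Record sgraph := SGraph {
  svertex :> finType;
  sedge : rel svertex;
  sedge_sym : symmetric sedge;
  sedge_irrefl : irreflexive sedge
}.

Notation "u -- v" := (sedge u v) (at level 70, no associativity).

Definition isomorphism (G H : sgraph) (f : G -> H) : Prop :=
  bijective f /\ {mono f : u v / u -- v}.

Definition isomorphic (G H : sgraph) : Prop :=
  exists f : G -> H, isomorphism f.

Notation "G ≅ H" := (isomorphic G H) (at level 70, no associativity).

Section Subsets.
Variable G : sgraph.
Implicit Types A B : {set G}.

Definition independent A : Prop := {in A &, forall u v, ~~ (u -- v)}.

Definition splits_vertices A B : Prop :=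
  A :|: B = [set: G] /\ A :&: B = set0.

Definition bipartition A B : Prop :=
  [/\ splits_vertices A B, independent A & independent B].

Definition adjacent_to_all (u : G) A : Prop := {in A, forall v, u -- v}.

Variable A : {set G}.

Definition induced_edge : rel {v : G | v \in A} :=
  fun u v => val u -- val v.

Lemma induced_sym : symmetric induced_edge.
Proof. by move=> u v; apply: sedge_sym. Qed.

Lemma induced_irrefl : irreflexive induced_edge.
Proof. by move=> u; apply: sedge_irrefl. Qed.

Definition induced := SGraph induced_sym induced_irrefl.

End Subsets.

Section StandardGraphs.
Variable k : nat.

Definition complete_edge : rel 'I_k := fun i j => i != j.

Lemma complete_sym : symmetric complete_edge.
Proof. by move=> i j; rewrite /complete_edge eq_sym. Qed.

Lemma complete_irrefl : irreflexive complete_edge.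
Proof. by move=> i; rewrite /complete_edge eqxx. Qed.

Definition complete_graph := SGraph complete_sym complete_irrefl.

Definition path_edge : rel 'I_k :=
  fun i j => (i.+1 == j :> nat) || (j.+1 == i :> nat).

Lemma path_sym : symmetric path_edge.
Proof. by move=> i j; rewrite /path_edge orbC. Qed.

Lemma path_irrefl : irreflexive path_edge.
Proof. by move=> i; rewrite /path_edge orbb gtn_eqF. Qed.

Definition path_graph := SGraph path_sym path_irrefl.

(* The conjunct i != j only matters for k = 1; this is a cycle for k >= 3. *)
Definition cycle_edge : rel 'I_k :=
  fun i j => (i != j) && ((i.+1 %% k == j) || (j.+1 %% k == i)).

Lemma cycle_sym : symmetric cycle_edge.
Proof. by move=> i j; rewrite /cycle_edge eq_sym orbC. Qed.

Lemma cycle_irrefl : irreflexive cycle_edge.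
Proof. by move=> i; rewrite /cycle_edge eqxx. Qed.

Definition cycle_graph := SGraph cycle_sym cycle_irrefl.

End StandardGraphs.

Section Pendant.
Variables (G : sgraph) (x : G).

(* None is the new vertex, attached to x. *)
Definition pendant_edge : rel (option G) := fun u v =>
  match u, v with
  | Some a, Some b => a -- b
  | Some a, None => a == x
  | None, Some b => b == x
  | None, None => false
  end.

Lemma pendant_sym : symmetric pendant_edge.
Proof. by move=> [a|] [b|] //=; apply: sedge_sym. Qed.

Lemma pendant_irrefl : irreflexive pendant_edge.
Proof. by move=> [a|] //=; apply: sedge_irrefl. Qed.

Definition add_pendant := SGraph pendant_sym pendant_irrefl.

End Pendant.

Section Gpn.
Variable p : nat.

Definition allowed (m : nat) : bool :=
  [&& 0 < m, odd m & [forall k : 'I_m.+1, (2 <= k) ==> (m != p * k)]].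

(* Bounding k by m in allowed loses nothing. *)
Lemma allowedP (m : nat) : 0 < p ->
  reflect [/\ 0 < m, odd m & forall k, 2 <= k -> m <> p * k] (allowed m).
Proof.
move=> p_gt0; apply: (iffP and3P) => -[m_gt0 m_odd Hm]; split=> //.
- move=> k k_ge2 Dm.
  have lt_k : k < m.+1 by rewrite ltnS Dm leq_pmull.
  by have /implyP/(_ k_ge2)/eqP := forallP Hm (Ordinal lt_k).
- by apply/forallP=> k; apply/implyP=> k_ge2; apply/eqP; apply: Hm.
Qed.

Variable n : nat.

Definition even_upto : seq nat := [seq 2 * i | i <- iota 1 n].

Definition Gvertex : finType := seq_sub even_upto.

(* The halvings are exact: all labels are even. *)
Definition Gedge : rel Gvertex := fun u v =>
  let a := ssval u in let b := ssval v in
  [&& u != v, allowed (a + b)./2 & allowed `|a - b|%N./2].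

Lemma Gsym : symmetric Gedge.
Proof. by move=> u v; rewrite /Gedge eq_sym addnC distnC. Qed.

Lemma Girrefl : irreflexive Gedge.
Proof. by move=> u; rewrite /Gedge eqxx. Qed.

Definition Ggraph := SGraph Gsym Girrefl.

Definition residue4 (r : nat) : {set Ggraph} :=
  [set v : Ggraph | ssval v %% 4 == r].

End Gpn.

Section Structure.
Variables (G : sgraph) (X Y : {set G}).

Definition opposite (u v : G) : Prop :=
  (u \in X /\ v \in Y) \/ (u \in Y /\ v \in X).

(* f enumerates the vertices of the induced path in path order; the boolean b
   records which kind of vertex the path starts with. *)
Definition path_independent_structure : Prop :=
  exists (I P : {set G}) (k : nat) (f : path_graph k -> induced P),
  [/\ splits_vertices I P /\ independent I,
      0 < k /\ isomorphism f,
      forall u, u \in P -> forall v, v \in I -> opposite u v -> u -- v,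
      exists b : bool, forall i : path_graph k,
        adjacent_to_all (val (f i)) (I :&: (if odd i (+) b then X else Y)) &
      forall u v : G, u -- v <->
        [\/ exists i j : path_graph k,
              [/\ i -- j, val (f i) = u & val (f j) = v],
            [/\ u \in P, v \in I & opposite u v]
          | [/\ v \in P, u \in I & opposite u v]]].

End Structure.

(* Main.v *)
Require Import Defs.
From HB Require Import structures.
From mathcomp Require Import all_boot all_order all_algebra.
From mathcomp Require Import zify.
Set Implicit Arguments.
Unset Strict Implicit.
Unset Printing Implicit Defensive.

(** Halve the labels, so that the vertices are [1, ..., n].  Two multiples of 3
    are never adjacent, since their sum is a multiple of 3 larger than 3.  If
    exactly one of [i], [j] is a multiple of 3, then 3 divides neither [i + j]
    nor [i - j], so adjacency just means opposite parity.  If neither is, then 3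
    divides one of [i + j], [i - j], which has to be 3 itself: the only edges are
    [{1, 2}] and [{i, i + 3}].  Hence the multiples of 3 form the independent
    set, and the other vertices form the path [..., 7, 4, 1, 2, 5, 8, ...]. *)

(** * Adjacency in terms of halved labels *)

Lemma allowed3E m : allowed 3 m = odd m && ((m %% 3 != 0) || (m == 3)).
Proof.
apply/(allowedP _ (isT : 0 < 3))/andP => [[m_gt0 m_odd m_ne]|[m_odd m_3]].
  split=> //; have [m0|//] := eqVneq (m %% 3) 0.
  (* Here [m] is 3 times this quotient, which is positive and below 2, so [m] is 3. *)
  have := m_ne (m %/ 3); lia.
split=> //; first lia.
move=> k; lia.
Qed.

Definition half_adj (i j : nat) : bool :=
  odd (i + j) &&
  (if (i %% 3 != 0) && (j %% 3 != 0)
   then [|| i + j == 3, i.+3 == j | j.+3 == i]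
   else (i %% 3 == 0) (+) (j %% 3 == 0)).

Lemma half_adjC i j : half_adj i j = half_adj j i.
Proof.
by rewrite /half_adj addnC [(i %% 3 != 0) && _]andbC [(i.+3 == j) || _]orbC addbC.
Qed.

(** By symmetry [i <= j], and the residues mod 3 leave finitely many linear cases. Positivity makes
    the sum of two multiples of 3 at least 6, hence never allowed. *)
Lemma half_adjE i j : 0 < i -> 0 < j ->
  half_adj i j = [&& i != j, allowed 3 (i + j) & allowed 3 `|i - j|%N].
Proof.
wlog le_ij : i j / i <= j.
  move=> half_adjE_le i0 j0; have [le_ij|/ltnW le_ji] := leqP i j.
    exact: half_adjE_le.
  by rewrite half_adjC eq_sym addnC distnC half_adjE_le.
rewrite distnEr // !allowed3E /half_adj.
move=> i0 j0; have := ltn_pmod j (isT : 0 < 3); have := ltn_pmod i (isT : 0 < 3).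
case Ei: (i %% 3) => [|[|[|//]]] _; case Ej: (j %% 3) => [|[|[|//]]] _ /=; lia.
Qed.

(** * Vertices, partite sets and isomorphisms through halved labels *)

Section Labels.
Variable n : nat.
Implicit Types u v : Ggraph 3 n.

Definition half_label u : nat := (ssval u)./2.

Lemma ssval_half_label u : ssval u = 2 * half_label u.
Proof.
by rewrite /half_label; have /mapP[i _ ->] := ssvalP u; rewrite !mul2n doubleK.
Qed.

Lemma half_label_bounds u : 0 < half_label u <= n.
Proof.
have /mapP[i] := ssvalP u.
by rewrite mem_iota ssval_half_label; lia.
Qed.

Lemma half_label_inj : injective half_label.
Proof.
by move=> u v uv; apply: val_inj; rewrite /= !ssval_half_label uv.
Qed.

Lemma mem_even_upto i : 0 < i <= n -> 2 * i \in even_upto n.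
Proof. by move=> i_n; apply/mapP; exists i => //; rewrite mem_iota; lia. Qed.

Definition half_vertex i (i_n : 0 < i <= n) : Ggraph 3 n :=
  SeqSub (mem_even_upto i_n).

Lemma half_vertexK i (i_n : 0 < i <= n) : half_label (half_vertex i_n) = i.
Proof. by rewrite /half_label /= mul2n doubleK. Qed.

Lemma sedge_half u v : u -- v = half_adj (half_label u) (half_label v).
Proof.
have /andP[u0 _] := half_label_bounds u.
have /andP[v0 _] := half_label_bounds v.
rewrite half_adjE // (inj_eq half_label_inj) /= /Gedge !ssval_half_label.
by congr [&& _, allowed 3 _ & allowed 3 _]; lia.
Qed.

Lemma residue4_0 u : (u \in residue4 3 n 0) = ~~ odd (half_label u).
Proof. by rewrite inE ssval_half_label; lia. Qed.

Lemma residue4_2 u : (u \in residue4 3 n 2) = odd (half_label u).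
Proof. by rewrite inE ssval_half_label; lia. Qed.

Lemma bipartition_residue4 : bipartition (residue4 3 n 0) (residue4 3 n 2).
Proof.
split; first split.
- by apply/setP=> u; rewrite in_setU residue4_0 residue4_2 inE orNb.
- by apply/setP=> u; rewrite in_setI residue4_0 residue4_2 inE andNb.
- by move=> u v; rewrite !residue4_0 sedge_half /half_adj oddD; do 2!case: odd.
- by move=> u v; rewrite !residue4_2 sedge_half /half_adj oddD; do 2!case: odd.
Qed.

(** The partite sets are the two parity classes of halved labels. *)
Lemma oppositeE u v : opposite (residue4 3 n 0) (residue4 3 n 2) u v <->
  odd (half_label u + half_label v).
Proof.
rewrite /opposite !residue4_0 !residue4_2 oddD.
by split; [case=> -[] | case: odd; case: odd => //= _; [right|left]];
  do 2?case: odd.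
Qed.

(* [l] is a labelling of the target [H] because the small target graphs have
   concrete vertices, unlike [Ggraph]. *)
Lemma isomorphic_of_labelling (H : sgraph) (l : H -> nat) :
    #|H| = n -> injective l -> (forall x, 0 < l x <= n) ->
    (forall x y, half_adj (l x) (l y) = (x -- y)) ->
  Ggraph 3 n ≅ H.
Proof.
move=> cardH l_inj l_bd l_adj.
pose g x := half_vertex (l_bd x).
have gl x : half_label (g x) = l x := half_vertexK (l_bd x).
have g_inj : injective g by move=> x y gxy; apply: l_inj; rewrite -!gl gxy.
(* An injection between finite sets of equal size is bijective; its inverse is the isomorphism
   sought. *)
have [f gK fK] : bijective g.
  apply: inj_card_bij g_inj _; rewrite cardH card_seq_sub ?size_map ?size_iota //.
  by rewrite map_inj_uniq ?iota_uniq // => i j; lia.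
exists f; split; first by exists g.
by move=> u v; rewrite -l_adj -!gl !fK sedge_half.
Qed.

(** * The independent set and the path *)

Definition triples : {set Ggraph 3 n} := [set u | half_label u %% 3 == 0].

Lemma half_adj_triple i j : i %% 3 != 0 -> j %% 3 == 0 ->
  half_adj i j = odd (i + j).
Proof. by move=> i3 /[dup] j3 /eqP j0; rewrite /half_adj j0 i3 (negPf i3) andbT. Qed.

Lemma independent_triples : independent triples.
Proof.
by move=> u v; rewrite !inE sedge_half /half_adj => /eqP-> /eqP->; rewrite andbF.
Qed.

(** The number of [i] in [1, n] congruent to 1 mod 3; the second summand of [k] counts those
    congruent to 2. *)
Let a := (n + 2) %/ 3.
Let k := a + (n + 1) %/ 3.

(* The path starts with the largest [i = 1 %[mod 3]], comes down to 1 at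
   position [a - 1], then goes up from 2. *)
Definition path_label (t : nat) : nat :=
  if t < a then 1 + 3 * (a.-1 - t) else 2 + 3 * (t - a).

(** The inverse of [path_label] on the non-multiples of 3 in [1, n]. *)
Definition path_position (i : nat) : nat :=
  if i %% 3 == 1 then a.-1 - i %/ 3 else a + i %/ 3.

Lemma path_label_bounds t : t < k -> 0 < path_label t <= n.
Proof. by rewrite /path_label /k /a => t_k; case: ifP; lia. Qed.

Lemma path_label_mod3 t : path_label t %% 3 != 0.
Proof. by rewrite /path_label; case: ifP => _; lia. Qed.

Lemma path_position_lt i : 0 < i <= n -> i %% 3 != 0 -> path_position i < k.
Proof. by rewrite /path_position /k /a => i_n i3; case: eqP; lia. Qed.

Lemma path_labelK t : t < k -> path_position (path_label t) = t.
Proof.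
by rewrite /path_position /path_label /k /a => t_k; case: ltnP; case: eqP; lia.
Qed.

Lemma path_positionK i : 0 < i <= n -> i %% 3 != 0 ->
  path_label (path_position i) = i.
Proof.
by rewrite /path_position /path_label /a => i_n i3; case: eqP; case: ltnP; lia.
Qed.

Lemma odd_path_label t : odd (path_label t) = odd (t + a).
Proof. by rewrite /path_label; case: ltnP; lia. Qed.

(** Within one residue class, adjacency means differing by 3, that is, being consecutive. Across the
    classes, only a sum of 3 is possible: labels 1 and 2, at positions [a - 1] and [a]. *)
Lemma half_adj_path s t : s < k -> t < k ->
  half_adj (path_label s) (path_label t) = (s.+1 == t) || (t.+1 == s).
Proof.
rewrite /half_adj !path_label_mod3 /= oddD !odd_path_label.
by rewrite /path_label /k /a => s_k t_k; case: (ltnP s); case: (ltnP t); lia.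
Qed.

Lemma path_independent_structure_residue4 : 0 < n ->
  path_independent_structure (residue4 3 n 0) (residue4 3 n 2).
Proof.
move=> n_gt0.
pose f0 (t : 'I_k) := half_vertex (path_label_bounds (ltn_ord t)).
have f0l t : half_label (f0 t) = path_label t by exact: half_vertexK.
have inP u : (u \in ~: triples) = (half_label u %% 3 != 0) by rewrite !inE.
have f0P t : f0 t \in ~: triples by rewrite inP f0l path_label_mod3.
pose f (t : path_graph k) : induced (~: triples) := exist _ (f0 t) (f0P t).
have posP (u : induced (~: triples)) : path_position (half_label (val u)) < k.
  by apply: path_position_lt; rewrite ?half_label_bounds // -inP (valP u).
pose g (u : induced (~: triples)) : path_graph k := Ordinal (posP u).
have gK : cancel g f.
  move=> u; apply: val_inj; apply: half_label_inj; rewrite /= f0l /=.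
  by apply: path_positionK; rewrite ?half_label_bounds // -inP (valP u).
have fK : cancel f g.
  by move=> t; apply: val_inj; rewrite /= f0l path_labelK.
have f_mono : {mono f : s t / s -- t}.
  move=> s t; transitivity (half_adj (path_label s) (path_label t)).
    by rewrite -!f0l; apply: sedge_half.
  exact: half_adj_path.
(* Between the path and the independent set, adjacency is exactly opposite parity. *)
have edge_opp u v : u \in ~: triples -> v \in triples ->
    opposite (residue4 3 n 0) (residue4 3 n 2) u v <-> u -- v.
  rewrite inP inE => u3 v3.
  by rewrite sedge_half half_adj_triple //; apply: oppositeE.
exists triples, (~: triples), k, f; split.
- split; last exact: independent_triples.
  by split; [exact: setUCr | exact: setICr].
- by split; [rewrite /k /a; lia | split=> //; exists g].
- by move=> u uP v vI /edge_opp; apply.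
(* The label at position [t] has the parity of [t + a], so an odd [t + a] puts it in Y and its
   neighbours in X. *)
- exists (odd a) => t v; rewrite in_setI => /andP[vI v_side].
  apply/edge_opp => //=; apply/oppositeE.
  rewrite f0l oddD odd_path_label oddD.
  by case: ifP v_side => _; rewrite ?residue4_0 ?residue4_2; case: odd.
- move=> u v; split=> [uv|].
  + have [uI|uP] := boolP (u \in triples).
      have vP : v \in ~: triples.
        by rewrite inE; apply: contraL uv; apply: independent_triples.
      (* Passing through the parity of the sum swaps the arguments of [opposite]. *)
      constructor 3; split=> //; apply/oppositeE; rewrite addnC; apply/oppositeE.
      by apply/edge_opp => //; rewrite sedge_sym.
    rewrite -in_setC in uP; have [vI|vP] := boolP (v \in triples).
      by constructor 2; split=> //; apply/edge_opp.
    rewrite -in_setC in vP; constructor 1.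
    (* Both ends lie on the path, so the edge is pulled back along [g]. *)
    exists (g (exist _ u uP)), (g (exist _ v vP)).
    by rewrite -f_mono !gK.
  + case=> [[s [t [st <- <-]]]|[uP vI]|[vP uI]]; first by rewrite -f_mono in st.
      by move/edge_opp; apply.
    move/oppositeE; rewrite addnC => /oppositeE/edge_opp; rewrite sedge_sym.
    exact.
Qed.

End Labels.

(** * The small cases, by explicit labellings *)

Lemma Ggraph31 : Ggraph 3 1 ≅ complete_graph 1.
Proof.
apply: (@isomorphic_of_labelling _ (complete_graph 1) (fun i => i.+1)).
- exact: card_ord.
- by move=> i j [/val_inj].
- by case.
- by do 2!case=> [[|//] ?].
Qed.

Lemma Ggraph32 : Ggraph 3 2 ≅ complete_graph 2.
Proof.
apply: (@isomorphic_of_labelling _ (complete_graph 2) (fun i => i.+1)).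
- exact: card_ord.
- by move=> i j [/val_inj].
- by case.
- by do 2!case=> [[|[|//]] ?].
Qed.

Lemma Ggraph33 : Ggraph 3 3 ≅ path_graph 3.
Proof.
apply: (@isomorphic_of_labelling _ (path_graph 3) (nth 0 [:: 1; 2; 3])).
- exact: card_ord.
- by do 2!case=> [[|[|[|//]]] ?] //; move=> _; apply: val_inj.
- by case=> [[|[|[|//]]] ?].
- by do 2!case=> [[|[|[|//]]] ?].
Qed.

(** The edge between 1 and 4, which differ by 3, closes the cycle 1, 2, 3, 4. *)
Lemma Ggraph34 : Ggraph 3 4 ≅ cycle_graph 4.
Proof.
apply: (@isomorphic_of_labelling _ (cycle_graph 4) (nth 0 [:: 1; 2; 3; 4])).
- exact: card_ord.
- by do 2!case=> [[|[|[|[|//]]]] ?] //; move=> _; apply: val_inj.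
- by case=> [[|[|[|[|//]]]] ?].
- by do 2!case=> [[|[|[|[|//]]]] ?].
Qed.

Lemma Ggraph35 : exists x : cycle_graph 4, Ggraph 3 5 ≅ add_pendant x.
Proof.
(* The only neighbour of 5 is 2, which labels index 1 of the cycle. *)
pose x : cycle_graph 4 := @Ordinal 4 1 isT; exists x.
pose l (u : add_pendant x) : nat :=
  if u is Some i then nth 0 [:: 1; 2; 3; 4] (i : 'I_4) else 5.
apply: (@isomorphic_of_labelling _ (add_pendant x) l).
- by rewrite card_option card_ord.
- case=> [[[|[|[|[|//]]]] ?]|] [[[|[|[|[|//]]]] ?]|] //= _;
    by congr Some; apply: val_inj.
- by case=> [[[|[|[|[|//]]]] ?]|].
- by case=> [[[|[|[|[|//]]]] ?]|] [[[|[|[|[|//]]]] ?]|].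
Qed.

Theorem theorem3p1 :
  (forall n : nat, 6 <= n ->
     let X := residue4 3 n 0 in
     let Y := residue4 3 n 2 in
     bipartition X Y /\ path_independent_structure X Y) /\
  [/\ Ggraph 3 1 ≅ complete_graph 1,
      Ggraph 3 2 ≅ complete_graph 2,
      Ggraph 3 3 ≅ path_graph 3,
      Ggraph 3 4 ≅ cycle_graph 4 &
      exists x : cycle_graph 4, Ggraph 3 5 ≅ add_pendant x].
Proof.
split=> [n n_ge6 X Y|].
  split; first exact: bipartition_residue4.
  by apply: path_independent_structure_residue4; apply: leq_trans n_ge6.
split; [exact: Ggraph31|exact: Ggraph32|exact: Ggraph33|exact: Ggraph34|].
exact: Ggraph35.
Qed.
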